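(* Let $d\ge 0$ be an integer. A partial cube $G$ has VC-dimension $\le d$ if and only if each hyperplane $H_i$ of $G$ has VC-dimension $\le d-1$.
   Context: All graphs are finite, connected and simple (hyperplanes below may be disconnected). $Q_m$ has as vertices the subsets of $\{1,\dots,m\}$, adjacent iff their symmetric difference has size $1$. A partial cube is a graph $G$ isometrically (distance-preservingly) embeddable in a hypercube; we identify it with its image in $Q_m$ (with $m$ minimal), an induced subgraph of $Q_m$, hence with a set family. The VC-dimension of a nonempty set family $\mathcal S$ (or of an induced subgraph of a hypercube with vertex set $\mathcal S$) is the maximum size of a set $X$ with $\{X\cap S:S\in\mathcal S\}=2^X$. The $\Theta$-class $E_i$ of $G$ is the set of edges of $G$ whose endpoints differ in element $i$. The hyperplane $H_i$ of $E_i$ has the edges of $E_i$ as vertices, two being adjacent iff they belong to a common 4-cycle of $G$; equivalently, $H_i$ is the subgraph of the hypercube on subsets of $\{1,\dots,m\}\setminus\{i\}$ induced by the sets $S\not\ni i$ such that both $S$ and $S\cup\{i\}$ are vertices of $G$. Its VC-dimension is that of this set family. *)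

(* Defs.v *)
From mathcomp Require Import all_boot all_order all_algebra.

Set Implicit Arguments.
Unset Strict Implicit.
Unset Printing Implicit Defensive.

Definition connected_simple_graph (T : finType) (e : rel T) : Prop :=
  [/\ 0 < #|T|, symmetric e, irreflexive e & forall x y, connect e x y].

Definition walk_of_length (T : finType) (e : rel T) (x y : T) (n : nat) : bool :=
  [exists p : n.-tuple T, path e x p && (last x p == y)].

(* The least length of a walk from x to y; a shortest walk has fewer than #|T|
   edges, and the value is #|T| when y is not reachable from x. *)
Definition gdist (T : finType) (e : rel T) (x y : T) : nat :=
  find (walk_of_length e x y) (iota 0 #|T|).

Definition symdiff (I : finType) (A B : {set I}) : {set I} :=
  (A :\: B) :|: (B :\: A).

Definition cube_adj (m : nat) : rel {set 'I_m} :=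
  fun A B => #|symdiff A B| == 1.

Definition isometric_embedding (T : finType) (e : rel T) (m : nat)
    (phi : T -> {set 'I_m}) : Prop :=
  forall x y, gdist (@cube_adj m) (phi x) (phi y) = gdist e x y.

Definition minimal_isometric_embedding (T : finType) (e : rel T) (m : nat)
    (phi : T -> {set 'I_m}) : Prop :=
  isometric_embedding e phi /\
  forall k (psi : T -> {set 'I_k}), isometric_embedding e psi -> m <= k.

Definition shatters (I : finType) (F : {set {set I}}) (X : {set I}) : bool :=
  [set X :&: S | S in F] == powerset X.

(* Meaningful for nonempty F only: no set is shattered by the empty family, for
   which the empty maximum returns 0. *)
Definition vcdim (I : finType) (F : {set {set I}}) : nat :=
  \max_(X : {set I} | shatters F X) #|X|.

Definition vertex_family (T : finType) (m : nat) (phi : T -> {set 'I_m}) :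
    {set {set 'I_m}} :=
  [set phi x | x : T].

(* No member contains i, so taking the ground set to be all of 'I_m instead of
   'I_m minus i does not change which sets are shattered. The family is nonempty
   as soon as some edge of the graph flips i. *)
Definition hyperplane (m : nat) (F : {set {set 'I_m}}) (i : 'I_m) :
    {set {set 'I_m}} :=
  [set S : {set 'I_m} | [&& i \notin S, S \in F & i |: S \in F]].

(* Main.v *)
Require Import Defs.
From mathcomp Require Import all_boot all_order all_algebra.

(** If a hyperplane [H_i] shatters [X] then [i] is outside [X] and [G] shatters
    [X + i]. Conversely, suppose that [G] shatters [X] and that [i] is in [X].
    For a subset [Y] of [X - i], a geodesic of [G] from a vertex with trace [Y]
    on [X] to one with trace [Y + i] is a geodesic of the hypercube, so it keeps
    the trace [Y] on [X - i]; the edge where it flips [i] is a vertex of [H_i]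
    with trace [Y]. Hence [H_i] shatters [X - i]. Minimality of the embedding
    only matters for [d = 0]: no coordinate is constant on [G], so a partial
    cube with a hyperplane has VC-dimension at least 1. *)

Lemma gdist_le_size {T : finType} {e : rel T} {x : T} {p : seq T} :
  path e x p -> gdist e x (last x p) <= size p.
Proof.
move=> ep; rewrite /gdist; set a := walk_of_length _ _ _.
have ap : a (size p) by apply/existsP; exists (in_tuple p); rewrite ep eqxx.
(* A walk with at least [#|T|] edges lies outside the range searched by [find], but [find] never
   exceeds the length of that range. *)
have [ltp|lep] := ltnP (size p) #|T|; last first.
  by apply: leq_trans lep; rewrite -[leqRHS](size_iota 0) find_size.
rewrite leqNgt; apply/negP => /(before_find 0).
by rewrite nth_iota // ap.
Qed.

(** Removing repetitions leaves a walk with fewer than [#|T|] edges, so the search in [gdist]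
    succeeds and its value is attained rather than the default. *)
Lemma geodesic_path {T : finType} {e : rel T} {x y : T} :
  connect e x y ->
  exists p, [/\ path e x p, last x p = y & size p = gdist e x y].
Proof.
case/connectP=> q0 /shortenP[q eq uq _] ->.
have ltq : size q < #|T| by move/card_uniqP: uq => /= <-; apply: max_card.
have hw : has (walk_of_length e x (last x q)) (iota 0 #|T|).
  apply/hasP; exists (size q); first by rewrite mem_iota.
  by apply/existsP; exists (in_tuple q); rewrite eq eqxx.
have := nth_find 0 hw; rewrite has_find size_iota in hw.
rewrite nth_iota // add0n => /existsP[p /andP[ep /eqP lp]].
by exists p; rewrite size_tuple.
Qed.

Lemma in_symdiff {I : finType} (A B : {set I}) (j : I) :
  (j \in symdiff A B) = ((j \in A) (+) (j \in B)).
Proof. by rewrite !inE; case: (j \in A); case: (j \in B). Qed.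

Lemma symdiff_sub {I : finType} (A B C : {set I}) :
  symdiff A C \subset symdiff A B :|: symdiff B C.
Proof.
apply/subsetP => j; rewrite in_setU !in_symdiff.
by case: (j \in A); case: (j \in B); case: (j \in C).
Qed.

Lemma card_symdiff_triangle {I : finType} (A B C : {set I}) :
  #|symdiff A C| <= #|symdiff A B| + #|symdiff B C|.
Proof.
apply: leq_trans (subset_leq_card (symdiff_sub A B C)) _.
exact: leq_card_setU.
Qed.

(** Equality in the triangle inequality makes the two differences disjoint: no coordinate flips
    twice on the way from [A] to [C] through [B]. *)
Lemma between_of_card_symdiff {I : finType} {A B C : {set I}} :
  #|symdiff A B| + #|symdiff B C| <= #|symdiff A C| ->
  A :&: C \subset B /\ B \subset A :|: C.
Proof.
rewrite -cardsUI => le; have dis : symdiff A B :&: symdiff B C = set0.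
  apply/eqP; rewrite -cards_eq0 -leqn0 -(leq_add2l #|symdiff A B :|: symdiff B C|).
  by rewrite addn0 (leq_trans le) // subset_leq_card // symdiff_sub.
have H j : ((j \in A) (+) (j \in B)) && ((j \in B) (+) (j \in C)) = false.
  by rewrite -!in_symdiff -in_setI dis inE.
split; apply/subsetP => j; move: (H j); rewrite !inE;
by case: (j \in A); case: (j \in B); case: (j \in C).
Qed.

Lemma card_symdiff_le_size {m : nat} {A : {set 'I_m}} {p : seq {set 'I_m}} :
  path (@cube_adj m) A p -> #|symdiff A (last A p)| <= size p.
Proof.
elim: p A => [|B p IH] A /=; first by rewrite /symdiff setDv setU0 cards0.
case/andP=> /eqP AB /IH leB.
by rewrite (leq_trans (card_symdiff_triangle A B _)) // AB add1n ltnS.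
Qed.

Lemma cube_path {m : nat} (A B : {set 'I_m}) :
  exists p, [/\ path (@cube_adj m) A p, last A p = B & size p = #|symdiff A B|].
Proof.
move: {2}#|symdiff A B| (erefl #|symdiff A B|) => n; elim: n A => [|n IH] A cAB.
  exists [::]; split; rewrite ?cAB //=; apply/setP => j.
  move/cards0_eq/setP/(_ j): cAB; rewrite in_symdiff inE.
  by case: (j \in A); case: (j \in B).
have [j jAB] : exists j, j \in symdiff A B by apply/card_gt0P; rewrite cAB.
pose A' := symdiff A [set j].
have AA' : symdiff A A' = [set j].
  by apply/setP => k; rewrite !in_symdiff addbA addbb.
have A'B : symdiff A' B = symdiff A B :\ j.
  apply/setP => k; rewrite in_setD1 !in_symdiff in_set1.
  have [->|_] := eqVneq k j; last by rewrite addbF.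
  by move: jAB; rewrite in_symdiff; case: (j \in A); case: (j \in B).
have [|p [ep lp sp]] := IH A'.
  by move: (cardsD1 j (symdiff A B)); rewrite -A'B jAB cAB => -[].
exists (A' :: p); split=> //=.
  by rewrite ep andbT /cube_adj AA' cards1.
by rewrite sp A'B [in RHS](cardsD1 j) jAB.
Qed.

(** Flipping the differing coordinates one by one gives the upper bound; the lower bound holds
    because an edge changes a single coordinate. *)
Lemma gdist_cube {m : nat} (A B : {set 'I_m}) :
  gdist (@cube_adj m) A B = #|symdiff A B|.
Proof.
have [p [ep lp sp]] := cube_path A B.
apply/eqP; rewrite eqn_leq -{1}lp -sp gdist_le_size // sp.
have [|q [eq lq <-]] := @geodesic_path _ (@cube_adj m) A B.
  by apply/connectP; exists p.
by rewrite -lq card_symdiff_le_size.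
Qed.

Lemma isometric_card_symdiff {T : finType} {e : rel T} {m : nat}
    {phi : T -> {set 'I_m}} :
  isometric_embedding e phi ->
  forall x y, #|symdiff (phi x) (phi y)| = gdist e x y.
Proof. by move=> iso x y; rewrite -gdist_cube. Qed.

(** Induction along the geodesic: either its first edge flips [i], or its tail is again a geodesic,
    whose end vertices span a smaller interval of the cube. *)
Lemma geodesic_crosses_hyperplane {T : finType} {e : rel T} {m : nat}
    {phi : T -> {set 'I_m}} {i : 'I_m} (iso : isometric_embedding e phi)
    {p : seq T} {x : T} :
  path e x p -> size p <= gdist e x (last x p) ->
  i \notin phi x -> i \in phi (last x p) ->
  exists2 S, S \in hyperplane (vertex_family phi) i &
    phi x :&: phi (last x p) \subset S /\ S \subset phi x :|: phi (last x p).
Proof.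
elim: p x => [|z p IH] x /=; first by move=> _ _ /negP.
case/andP=> exz ep; set y := last z p => lep ix iy.
have xz : #|symdiff (phi x) (phi z)| <= 1.
  rewrite (isometric_card_symdiff iso).
  by apply: (@gdist_le_size _ e x [:: z]); rewrite /= exz.
have zy : #|symdiff (phi z) (phi y)| <= size p.
  by rewrite (isometric_card_symdiff iso) gdist_le_size.
have xy : (size p).+1 <= #|symdiff (phi x) (phi y)|.
  by rewrite (isometric_card_symdiff iso).
have [|sub1 sub2] := @between_of_card_symdiff _ (phi x) (phi z) (phi y).
  by apply: leq_trans xy; rewrite -add1n leq_add.
have [iz|iz] := boolP (i \in phi z).
  have phiz : phi z = i |: phi x.
    have /eqP xzi : [set i] == symdiff (phi x) (phi z).
      by rewrite eqEcard cards1 xz andbT sub1set in_symdiff (negPf ix) iz.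
    apply/setP => j; move/setP/(_ j): xzi; rewrite in_symdiff !inE.
    case: (eqVneq j i) => [->|_]; first by rewrite iz.
    by case: (j \in phi x); case: (j \in phi z).
  exists (phi x); last by rewrite subsetIl subsetUl.
  by rewrite inE ix -phiz !imset_f.
(* A shortcut from [z] to [y] would, by the triangle inequality, shorten the whole geodesic from
   [x]. *)
have [//||//|//|S HS [zyS Szy]] := IH z.
  rewrite -/y -(isometric_card_symdiff iso) -ltnS (leq_trans xy) //.
  by rewrite (leq_trans (card_symdiff_triangle _ (phi z) _)) // -add1n leq_add.
exists S => //; split.
  by apply: subset_trans zyS; rewrite subsetI sub1 subsetIr.
by apply: subset_trans Szy _; rewrite subUset sub2 subsetUr.
Qed.

Lemma shattersP {I : finType} {F : {set {set I}}} {X : {set I}} :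
  reflect (forall Y : {set I}, Y \subset X -> exists2 S, S \in F & X :&: S = Y)
          (shatters F X).
Proof.
apply: (iffP eqP) => [eqF Y|sh].
  by rewrite -powersetE -eqF => /imsetP[S FS ->]; exists S.
apply/setP => Y; rewrite powersetE; apply/imsetP/idP => [[S _ ->]|/sh[S FS <-]].
  exact: subsetIl.
by exists S.
Qed.

Lemma leq_vcdim {I : finType} {F : {set {set I}}} {X : {set I}} :
  shatters F X -> #|X| <= vcdim F.
Proof. exact: (@leq_bigmax_cond _ _ (fun X : {set I} => #|X|)). Qed.

(** A member [S] of the hyperplane supplies both [S] and [i |: S] in [F], so the trace at [i] can be
    chosen freely. *)
Lemma shatters_setU1_hyperplane {m : nat} {F : {set {set 'I_m}}} {i : 'I_m}
    {X : {set 'I_m}} :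
  shatters (hyperplane F i) X -> i \notin X /\ shatters F (i |: X).
Proof.
move/shattersP=> sh; have iX : i \notin X.
  have [S] := sh X (subxx X); rewrite inE => /and3P[iS _ _] <-.
  by rewrite inE negb_and iS orbT.
split=> //; apply/shattersP => Y YX.
have [|S] := sh (Y :\ i); first by rewrite subDset.
rewrite inE => /and3P[iS FS FiS] eqS.
have XS j : j != i -> (j \in X) && (j \in S) = (j \in Y).
  by move=> ji; move/setP/(_ j): eqS; rewrite !inE ji.
case iY: (i \in Y); [exists (i |: S) | exists S] => //; apply/setP => j;
  rewrite !inE; case: (eqVneq j i) => [->|ji] /=;
  rewrite ?iY ?(negPf iS) //; exact: XS.
Qed.

Lemma shatters_hyperplane_setD1 {T : finType} {e : rel T} {m : nat}
    {phi : T -> {set 'I_m}} {i : 'I_m} {X : {set 'I_m}} :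
  (forall x y, connect e x y) -> isometric_embedding e phi -> i \in X ->
  shatters (vertex_family phi) X ->
  shatters (hyperplane (vertex_family phi) i) (X :\ i).
Proof.
move=> con iso iX /shattersP sh; apply/shattersP => Y YX.
have iY : i \notin Y by apply/negP => /(subsetP YX); rewrite !inE eqxx.
have YX' : Y \subset X by apply: subset_trans YX (subD1set _ _).
have [_ /imsetP[x _ ->] xY] := sh Y YX'.
have [|_ /imsetP[y _ ->] yY] := sh (i |: Y); first by rewrite subUset sub1set iX.
have ix : i \notin phi x.
  by move/setP/(_ i): xY; rewrite inE iX (negPf iY) /= => ->.
have iy : i \in phi y by move/setP/(_ i): yY; rewrite !inE iX eqxx.
have [p [ep lp sp]] := geodesic_path (con x y).
rewrite -lp in iy.
have [|S HS []] := geodesic_crosses_hyperplane iso ep _ ix iy.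
  by rewrite lp sp.
(* On [X :\ i] both [phi x] and [phi y] have trace [Y], so their intersection and union do too, and
   [S] is squeezed between these. *)
rewrite lp => /subsetP xyS /subsetP Sxy; exists S => //; apply/setP => j.
move: (xyS j) (Sxy j); move/setP/(_ j): xY; move/setP/(_ j): yY; rewrite !inE.
case: (eqVneq j i) => [->|ji] /=; first by rewrite (negPf iY).
case: (j \in X) => //= -> ->; rewrite andbb orbb => YS SY.
by apply/idP/idP.
Qed.

Lemma minimal_embedding_coord_nonconstant {T : finType} {e : rel T} {m : nat}
    {phi : T -> {set 'I_m}} :
  minimal_isometric_embedding e phi ->
  forall i, exists x y, (i \in phi x) && (i \notin phi y).
Proof.
case: m phi => [|k] phi [iso min] i; first by case: i.
have [/existsP[x /existsP[y]]|/existsPn no] :=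
    boolP [exists x, exists y, (i \in phi x) && (i \notin phi y)].
  by exists x, y.
have cst x y : (i \in phi x) = (i \in phi y).
  move: (existsPn (no x) y) (existsPn (no y) x).
  by case: (i \in phi x); case: (i \in phi y).
(* Deleting the constant coordinate [i] preserves all distances, which contradicts the minimality of
   [k.+1]. *)
pose psi x := [set j | lift i j \in phi x].
suff /min : isometric_embedding e psi by rewrite ltnn.
move=> x y; rewrite gdist_cube -(isometric_card_symdiff iso).
rewrite -(card_imset _ (@lift_inj _ i)); congr #|pred_of_set _|.
apply/setP => j; apply/imsetP/idP => [[l + ->]|].
  by rewrite !in_symdiff !inE.
case: (unliftP i j) => [l ->|->]; last by rewrite in_symdiff (cst x y) addbb.
by rewrite in_symdiff => H; exists l; rewrite // in_symdiff !inE.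
Qed.

Lemma shatters_set1 {I : finType} {F : {set {set I}}} {i : I} {A B : {set I}} :
  A \in F -> B \in F -> i \in A -> i \notin B -> shatters F [set i].
Proof.
move=> FA FB iA iB; apply/shattersP => Y; rewrite subset1 => /orP[]/eqP->.
  by exists A => //; apply/setIidPl; rewrite sub1set.
exists B => //; apply/setP => j; rewrite !inE.
by case: (eqVneq j i) => [->|//]; rewrite (negPf iB).
Qed.

Theorem proposition6 (T : finType) (e : rel T) (m : nat)
    (phi : T -> {set 'I_m}) (d : nat)
    (hG : connected_simple_graph e)
    (hphi : minimal_isometric_embedding e phi) :
  vcdim (vertex_family phi) <= d <->
  (forall i : 'I_m,
     ((vcdim (hyperplane (vertex_family phi) i))%:Z <= d%:Z - 1)%R).
Proof.
have leE v : ((v%:Z <= d%:Z - 1)%R) = (v < d).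
  by rewrite Num.Theory.lerBrDr -PoszD lez_nat addn1.
split=> [led i|H].
  have [x [y /andP[ix iy]]] := minimal_embedding_coord_nonconstant hphi i.
  (* For [d = 0] the bound on a hyperplane would be negative, hence false; two vertices that differ
     at [i] shatter [[set i]] and exclude this case. *)
  have dgt0 : 0 < d.
    rewrite (leq_trans _ led) // -(cards1 i) leq_vcdim //.
    by apply: shatters_set1 ix iy; apply: imset_f.
  rewrite leE -(prednK dgt0) ltnS; apply/bigmax_leqP => X.
  case/shatters_setU1_hyperplane => iX /leq_vcdim.
  by rewrite cardsU1 iX add1n => lt; rewrite -ltnS prednK // (leq_trans lt).
apply/bigmax_leqP => X shX.
have [->|[i iX]] := set_0Vmem X; first by rewrite cards0.
case: hG hphi => _ _ _ con [iso _].
have /leq_vcdim leX := shatters_hyperplane_setD1 con iso iX shX.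
by move: (H i); rewrite leE (cardsD1 i) iX; apply: leq_ltn_trans.
Qed.
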